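(* Let $\phi\in\mathbb{S}$, and let $A=S_1+K_1$ and $B=S_2+K_2$ be the $\phi$-HSH decompositions of quaternionic matrices $A,B\in M_n(\mathbb{H})$. Then the following statements are equivalent. (1) $A$ and $B$ are unitarily $\phi$-congruent. (2) The families $\{S_1,K_1\}$ and $\{S_2,K_2\}$ are unitarily $\phi$-congruent. (3) The families $\{S_1,K_1\}$ and $\{S_2,K_2\}$ are $\phi$-similar.
   Context: $\mathbb{H}$ denotes the real quaternions, $M_n(\mathbb{H})$ the $n\times n$ quaternionic matrices, $A^*$ the conjugate transpose; $U$ is unitary if $UU^*=U^*U=I$. $\mathbb{S}=\{\phi\in\mathbb{H}:|\phi|=1,\ \mathrm{Re}(\phi)=0\}$. For $A\in M_n(\mathbb{H})$, $\overline{A}^{\phi}=\overline{\phi}A\phi$ (entrywise multiplication) and $A^{*\phi}=\overline{A^*}^{\phi}=\overline{\phi}A^*\phi$. The $\phi$-HSH decomposition of $A$ is $A=S+K$ with $S=\frac12(A+\overline{A^*}^{\phi})$ and $K=\frac12(A-\overline{A^*}^{\phi})$. $A$ and $B$ are unitarily $\phi$-congruent if there is a unitary $U\in M_n(\mathbb{H})$ with $UA(\overline{U}^{\phi})^{-1}=UAU^{*\phi}=B$, and $\phi$-similar if there is an invertible $P\in M_n(\mathbb{H})$ with $PA(\overline{P}^{\phi})^{-1}=B$. For families, $\{S_1,K_1\}$ and $\{S_2,K_2\}$ are unitarily $\phi$-congruent (resp. $\phi$-similar) if one and the same unitary $U$ (resp. invertible $P$) takes $S_1$ to $S_2$ and $K_1$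 to $K_2$ in this way. *)

(* Defs.v *)
From HB Require Import structures.
From mathcomp Require Import all_boot all_order all_algebra.
From mathcomp Require Import ring lra.
From mathcomp Require Export reals.

Set Implicit Arguments.
Unset Strict Implicit.
Unset Printing Implicit Defensive.
Import Order.TTheory GRing.Theory Num.Theory.
Local Open Scope ring_scope.

(* [Quat a b c d] is a + b i + c j + d k. *)
Record quat (R : Type) := Quat { qRe : R; qI : R; qJ : R; qK : R }.

Section QuatChoice.

Definition tuple_of_quat (R : Type) (x : quat R) := (qRe x, qI x, qJ x, qK x).
Definition quat_of_tuple (R : Type) (t : R * R * R * R) : quat R :=
  let: (a, b, c, d) := t in Quat a b c d.

Lemma tuple_of_quatK (R : Type) :
  cancel (@tuple_of_quat R) (@quat_of_tuple R).
Proof. by case. Qed.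

HB.instance Definition _ (R : eqType) :=
  Equality.copy (quat R) (can_type (@tuple_of_quatK R)).
HB.instance Definition _ (R : choiceType) :=
  Choice.copy (quat R) (can_type (@tuple_of_quatK R)).

End QuatChoice.

Section QuatRing.
Variable R : rcfType.
Implicit Types x y z : quat R.

Definition addq x y :=
  Quat (qRe x + qRe y) (qI x + qI y) (qJ x + qJ y) (qK x + qK y).
Definition oppq x := Quat (- qRe x) (- qI x) (- qJ x) (- qK x).

Fact addqA : associative addq.
Proof. by move=> x y z; rewrite /addq /= !addrA. Qed.
Fact addqC : commutative addq.
Proof.
move=> x y; rewrite /addq.
by congr Quat; rewrite addrC.
Qed.
Fact add0q : left_id (Quat 0 0 0 0) addq.
Proof. by case=> a b c d; rewrite /addq /= !add0r. Qed.
Fact addNq : left_inverse (Quat 0 0 0 0) oppq addq.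
Proof. by move=> x; rewrite /addq /= !addNr. Qed.

HB.instance Definition _ :=
  GRing.isZmodule.Build (quat R) addqA addqC add0q addNq.

Definition mulq x y :=
  Quat (qRe x * qRe y - qI x * qI y - qJ x * qJ y - qK x * qK y)
       (qRe x * qI y + qI x * qRe y + qJ x * qK y - qK x * qJ y)
       (qRe x * qJ y - qI x * qK y + qJ x * qRe y + qK x * qI y)
       (qRe x * qK y + qI x * qJ y - qJ x * qI y + qK x * qRe y).

Fact mulqA : associative mulq.
Proof. by move=> x y z; rewrite /mulq /=; congr Quat; ring. Qed.
Fact mul1q : left_id (Quat 1 0 0 0) mulq.
Proof. by case=> a b c d; rewrite /mulq /=; congr Quat; ring. Qed.
Fact mulq1 : right_id (Quat 1 0 0 0) mulq.
Proof. by case=> a b c d; rewrite /mulq /=; congr Quat; ring. Qed.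
Fact mulqDl : left_distributive mulq addq.
Proof. by move=> x y z; rewrite /mulq /addq /=; congr Quat; ring. Qed.
Fact mulqDr : right_distributive mulq addq.
Proof. by move=> x y z; rewrite /mulq /addq /=; congr Quat; ring. Qed.
Fact oneq_neq0 : Quat 1 0 0 0 != 0 :> quat R.
Proof. by apply/eqP; case=> /eqP; rewrite oner_eq0. Qed.

HB.instance Definition _ :=
  GRing.Zmodule_isNzRing.Build (quat R) mulqA mul1q mulq1 mulqDl mulqDr oneq_neq0.

Definition qconj x := Quat (qRe x) (- qI x) (- qJ x) (- qK x).
Definition qnorm2 x := qRe x ^+ 2 + qI x ^+ 2 + qJ x ^+ 2 + qK x ^+ 2.
Definition qnorm x := Num.sqrt (qnorm2 x).

Lemma qnorm2_eq0 x : (qnorm2 x == 0) = (x == 0).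
Proof.
apply/eqP/eqP => [|->]; last by rewrite /qnorm2 /= expr0n /= !addr0.
case: x => a b c d; rewrite /qnorm2 /= => h.
have ha := sqr_ge0 a; have hb := sqr_ge0 b.
have hc := sqr_ge0 c; have hd := sqr_ge0 d.
have e (t : R) : t ^+ 2 <= 0 -> t = 0.
  by move=> ht; apply/eqP; rewrite -sqrf_eq0 eq_le ht sqr_ge0.
by rewrite -[RHS]/(Quat 0 0 0 0); congr Quat; apply: e; lra.
Qed.

Definition invq x :=
  let m := qnorm2 x in Quat (qRe x / m) (- qI x / m) (- qJ x / m) (- qK x / m).

Fact mulVq : {in [pred x | x != 0], left_inverse (Quat 1 0 0 0) invq mulq}.
Proof.
move=> x; rewrite inE -qnorm2_eq0 /qnorm2 => h.
by rewrite /mulq /invq /qnorm2 /=; congr Quat; field.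
Qed.
Fact mulqV : {in [pred x | x != 0], right_inverse (Quat 1 0 0 0) invq mulq}.
Proof.
move=> x; rewrite inE -qnorm2_eq0 /qnorm2 => h.
by rewrite /mulq /invq /qnorm2 /=; congr Quat; field.
Qed.
Fact unitq x y : y * x = 1 /\ x * y = 1 -> x != 0.
Proof.
case=> h _; apply/eqP => x0; move: h; rewrite x0 mulr0 => /esym/eqP.
by rewrite oner_eq0.
Qed.
Fact invq_out : {in [predC [pred x | x != 0]], invq =1 id}.
Proof.
by move=> x; rewrite !inE negbK => /eqP->; rewrite /invq /= oppr0 !mul0r.
Qed.

HB.instance Definition _ :=
  GRing.NzRing_hasMulInverse.Build (quat R) mulVq mulqV unitq invq_out.

Definition unit_imag x : Prop := qnorm x = 1 /\ qRe x = 0.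

End QuatRing.

Section QuatMatrix.
Variables (R : rcfType) (n : nat).
Implicit Types (phi : quat R) (A B S K P Q U : 'M[quat R]_n).

Definition adjmx A : 'M[quat R]_n := map_mx (@qconj R) A^T.

Definition phi_conj phi A : 'M[quat R]_n :=
  map_mx (fun x => qconj phi * x * phi) A.

Definition phi_adj phi A : 'M[quat R]_n := phi_conj phi (adjmx A).

(* [quat R] is not commutative, so [invmx] and [unitmx] are not available. *)
Definition is_inverse P Q : Prop := P *m Q = 1%:M /\ Q *m P = 1%:M.

Definition invertible P : Prop := exists Q, is_inverse P Q.

Definition unitary U : Prop :=
  U *m adjmx U = 1%:M /\ adjmx U *m U = 1%:M.

(* Here [2^-1] is an element of [quat R]. *)
Definition is_phi_HSH phi A S K : Prop :=
  [/\ A = S + K,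
      S = 2^-1 *: (A + phi_adj phi A) &
      K = 2^-1 *: (A - phi_adj phi A)].

Definition phi_congr_by phi U A B : Prop := U *m A *m phi_adj phi U = B.

Definition phi_sim_by phi P A B : Prop :=
  exists2 Q, is_inverse (phi_conj phi P) Q & P *m A *m Q = B.

Definition unitarily_phi_congruent phi A B : Prop :=
  exists2 U, unitary U & phi_congr_by phi U A B.

Definition pair_unitarily_phi_congruent phi S1 K1 S2 K2 : Prop :=
  exists2 U, unitary U & phi_congr_by phi U S1 S2 /\ phi_congr_by phi U K1 K2.

Definition pair_phi_similar phi S1 K1 S2 K2 : Prop :=
  exists2 P, invertible P & phi_sim_by phi P S1 S2 /\ phi_sim_by phi P K1 K2.

Lemma is_phi_HSH_exists phi A :
  is_phi_HSH phi A (2^-1 *: (A + phi_adj phi A)) (2^-1 *: (A - phi_adj phi A)).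
Proof.
split=> //; rewrite -scalerDr addrACA subrr addr0 -mulr2n -scaler_nat scalerA.
rewrite mulVr ?scale1r // -[_ \is a _]/((2 : quat R) != 0).
apply/eqP => h; have : qRe (2 : quat R) = 0 by rewrite h.
by apply/eqP; rewrite -[qRe _]/(2%:R : R) pnatr_eq0.
Qed.

Lemma unit_imag_mul phi :
  unit_imag phi -> qconj phi * phi = 1 /\ phi * qconj phi = 1.
Proof.
case=> h h0; have {h}h : qnorm2 phi = 1.
  rewrite -[LHS]sqr_sqrtr; first by rewrite [Num.sqrt _]h expr1n.
  by rewrite /qnorm2 !addr_ge0 ?sqr_ge0.
by split; rewrite /*%R /= /mulq /=; congr Quat; rewrite -?h /qnorm2; ring.
Qed.

Lemma phi_conjM phi A B : unit_imag phi ->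
  phi_conj phi (A *m B) = phi_conj phi A *m phi_conj phi B.
Proof.
case/unit_imag_mul=> _ h; apply/matrixP=> i j; rewrite !mxE mulr_sumr mulr_suml.
apply: eq_bigr => k _; rewrite !mxE !mulrA.
by rewrite -[_ * phi * qconj phi]mulrA h mulr1.
Qed.

Lemma phi_conj1 phi : unit_imag phi -> phi_conj phi 1%:M = 1%:M.
Proof.
case/unit_imag_mul=> h _; apply/matrixP=> i j; rewrite !mxE.
by case: (i == j); rewrite ?mulr0 ?mul0r // mulr1 h.
Qed.

(* For unitary U, the inverse of [phi_conj phi U] is [phi_adj phi U], so that
   [phi_congr_by] is [phi_sim_by] by a unitary matrix. *)
Lemma unitary_phi_sim phi U A B : unit_imag phi -> unitary U ->
  phi_congr_by phi U A B <-> phi_sim_by phi U A B.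
Proof.
move=> hphi [h1 h2].
have [e1 e2] : is_inverse (phi_conj phi U) (phi_adj phi U).
  by rewrite /is_inverse /phi_adj -!phi_conjM // h1 h2 phi_conj1.
split=> [h | [Q [q1 q2] <-]]; first by exists (phi_adj phi U).
by rewrite /phi_congr_by -[Q]mul1mx -e2 -[_ *m _ *m Q]mulmxA q1 mulmx1.
Qed.

End QuatMatrix.

(* Main.v *)
Require Import Defs.
From HB Require Import structures.
From mathcomp Require Import all_boot all_order all_algebra reals.
From mathcomp Require Import ring lra complex.

Set Implicit Arguments.
Unset Strict Implicit.
Unset Printing Implicit Defensive.
Import Order.TTheory GRing.Theory Num.Theory.
Local Open Scope ring_scope.

(** Write F for the scalar matrix with phi on its diagonal. Since phi is a unit
imaginary quaternion, [F *m F = - 1%:M], and the phi-conjugate of A is - F A F.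
Multiplying by F on the right turns the twisted relations into ordinary ones:
a phi-similarity P A Q = B, with Q the inverse of the phi-conjugate of P, says
that P (A F) = (B F) P ([phi_sim_intertwine]), and the same holds with a
unitary U in place of P ([intertwine_phi_congr]). Moreover S = S^*phi says that
S F is skew-Hermitian, and K = - K^*phi that K F is Hermitian
([adjmx_mul_imag]).

Unitary phi-congruence commutes with the phi-adjoint, hence carries the two
parts of A to those of B: (1) implies (2). For (2) implies (3), the
phi-adjoint of a unitary U is the inverse of its phi-conjugate.
For (3) implies (1), let P intertwine S1 F with S2 F and K1 F with K2 F. As
these matrices are Hermitian or skew-Hermitian, P also intertwines their
adjoints, so they commute with the Gram matrix M = P^* P. In the polar
decomposition P = U M^(1/2), the factor M^(1/2) is a real polynomial in M, so
it commutes with them as well, and the unitary U = P M^(-1/2) intertwines the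
same pairs ([polar_intertwiner]). Adding the two congruences gives (1).

The inverse square root of M is produced without a spectral theorem over the
quaternions. Quaternionic matrices form a finite-dimensional real space, so
some nonzero real polynomial annihilates M ([annihilating_poly]). A sum
A^* A + B^* B vanishes only if A and B do ([adjmx_sum_sqr_eq0]), which allows one
to discard the irreducible quadratic factors, the factors with a root that is
not positive, and the repeated factors ([positive_split]). What remains is a
product of distinct factors X - a with a > 0, and a polynomial that takes the
value 1 / sqrt a at each such a gives the inverse square root
([inverse_sqrt]). *)

(** * The quaternionic adjoint and its positivity *)

Section Adjoint.
Variable R : rcfType.
Implicit Types x y : quat R.

Lemma mulqE x y : x * y = Defs.mulq x y.
Proof. by []. Qed.

Lemma qconjD : {morph @qconj R : x y / x + y}.
Proof. by move=> x y; rewrite [RHS]/+%R /= /Defs.addq /qconj /= !opprD. Qed.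

Lemma qconjM x y : qconj (x * y) = qconj y * qconj x.
Proof. by rewrite !mulqE /Defs.mulq /qconj /=; congr Quat; ring. Qed.

Lemma qconjK : involutive (@qconj R).
Proof. by case=> a b c d; rewrite /qconj /= !opprK. Qed.

Lemma qconj0 : qconj 0 = 0 :> quat R.
Proof. by rewrite /qconj /= !oppr0. Qed.

Lemma qReD : {morph @qRe R : x y / x + y}.
Proof. by []. Qed.

Lemma qRe_conjM x : qRe (qconj x * x) = qnorm2 x.
Proof. by rewrite mulqE /qnorm2 /qconj /=; ring. Qed.

Lemma qnorm2_ge0 x : 0 <= qnorm2 x.
Proof. by rewrite /qnorm2 !addr_ge0 ?sqr_ge0. Qed.

Lemma adjmxD n : {morph @adjmx R n : A B / A + B}.
Proof. by move=> A B; apply/matrixP=> i j; rewrite !mxE qconjD. Qed.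

Lemma adjmxN n : {morph @adjmx R n : A / - A}.
Proof.
move=> A; apply/eqP; rewrite -addr_eq0 -adjmxD addNr.
by apply/eqP/matrixP=> i j; rewrite !mxE qconj0.
Qed.

Lemma adjmxB n : {morph @adjmx R n : A B / A - B}.
Proof. by move=> A B; rewrite adjmxD adjmxN. Qed.

Lemma adjmxM n (A B : 'M[quat R]_n) : adjmx (A *m B) = adjmx B *m adjmx A.
Proof.
apply/matrixP=> i j; rewrite !mxE (big_morph _ qconjD qconj0).
by apply: eq_bigr => k _; rewrite !mxE qconjM.
Qed.

Lemma adjmxK n : involutive (@adjmx R n).
Proof. by move=> A; apply/matrixP=> i j; rewrite !mxE qconjK. Qed.

Lemma adjmx_scalar n x : adjmx (x%:M : 'M_n) = (qconj x)%:M.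
Proof.
apply/matrixP=> i j; rewrite !mxE eq_sym.
by case: (i == j); rewrite ?mulr1n ?mulr0n ?qconj0.
Qed.

Lemma adjmx1 n : adjmx (1%:M : 'M[quat R]_n) = 1%:M.
Proof. by rewrite adjmx_scalar; congr _%:M; rewrite /qconj /= oppr0. Qed.

(** The real part of a diagonal entry of A^* A is the squared norm of a column
of A, so the hypothesis is a vanishing sum of nonnegative reals. The second
summand is what excludes quadratic and nonpositive factors below. *)
Lemma adjmx_sum_sqr_eq0 n (A B : 'M[quat R]_n) :
  adjmx A *m A + adjmx B *m B = 0 -> A = 0.
Proof.
move=> h; apply/matrixP=> i j; rewrite mxE; apply/eqP; rewrite -qnorm2_eq0.
have tr (C : 'M[quat R]_n) :
    qRe ((adjmx C *m C) j j) = \sum_k qnorm2 (C k j).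
  rewrite mxE (big_morph _ qReD erefl); apply: eq_bigr => k _.
  by rewrite !mxE qRe_conjM.
have ge0 (C : 'M[quat R]_n) : 0 <= \sum_k qnorm2 (C k j).
  by apply: sumr_ge0 => k _; apply: qnorm2_ge0.
have : qRe ((adjmx A *m A + adjmx B *m B) j j) = 0 by rewrite h mxE.
rewrite mxE qReD !tr => /eqP; rewrite paddr_eq0 // => /andP[+ _].
rewrite psumr_eq0 => [/allP/(_ i)|k _]; last exact: qnorm2_ge0.
by apply; rewrite mem_index_enum.
Qed.

End Adjoint.

(** * Real polynomials of a quaternionic matrix *)

Section RealPolynomials.
Variables (R : rcfType) (n : nat).
Notation MH := 'M[quat R]_n.+1.
Implicit Types (M N X : MH) (p q : {poly R}).

(** Real scalars are central, so evaluating a real polynomial at a quaternionic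
matrix is a ring morphism, which fails for quaternionic coefficients. *)
Definition realmx (a : R) : MH := (Quat a 0 0 0)%:M.

Fact realmx_is_zmod_morphism : zmod_morphism realmx.
Proof.
move=> a b; rewrite /realmx -raddfB; congr _%:M.
by rewrite /GRing.add /= /Defs.addq /= !subr0.
Qed.
Fact realmx_is_monoid_morphism : monoid_morphism realmx.
Proof.
split=> // a b; rewrite /realmx -[RHS]scalar_mxM; congr _%:M.
by rewrite !mulqE /Defs.mulq /=; congr Quat; ring.
Qed.
HB.instance Definition _ :=
  GRing.isZmodMorphism.Build R MH realmx realmx_is_zmod_morphism.
HB.instance Definition _ :=
  GRing.isMonoidMorphism.Build R MH realmx realmx_is_monoid_morphism.

Lemma adjmx_real a : adjmx (realmx a) = realmx a.
Proof. by rewrite adjmx_scalar /qconj /= oppr0. Qed.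

Lemma mul_realmx (a : R) N i j : (realmx a * N) i j = Quat a 0 0 0 * N i j.
Proof. by rewrite -[realmx a * N]/(_ *m _) mul_scalar_mx mxE. Qed.

Lemma realmx_comm M : commr_rmorph realmx M.
Proof.
move=> a; apply/matrixP=> i j; rewrite mul_realmx mxE (bigD1 j) //= big1.
  rewrite !mxE eqxx addr0 mulr1n !mulqE /Defs.mulq /=.
  by congr Quat; ring.
by move=> k nkj; rewrite !mxE (negPf nkj) mulr0.
Qed.

Notation ev M := (horner_morph (realmx_comm M)).

Lemma evXsubC M a : ev M ('X - a%:P) = M - realmx a.
Proof. by rewrite rmorphB /= horner_morphX horner_morphC. Qed.

Lemma ev_comm M X p : GRing.comm X M -> GRing.comm X (ev M p).
Proof.
move=> XM; elim/poly_ind: p => [|p c IH]; first by rewrite rmorph0; apply: commr0.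
rewrite rmorphD rmorphM /= horner_morphX horner_morphC.
by apply: commrD; [apply: commrM | apply: realmx_comm].
Qed.

Lemma adjmx_ev M p : adjmx M = M -> adjmx (ev M p) = ev M p.
Proof.
move=> hM; elim/poly_ind: p => [|p c IH].
  by rewrite rmorph0 -[X in adjmx X](subrr 0) adjmxB subrr.
rewrite rmorphD rmorphM /= horner_morphX horner_morphC.
rewrite adjmxD adjmx_real [adjmx (_ * _)]adjmxM IH hM.
by congr (_ + _); apply: ev_comm.
Qed.

Definition qcoord (x : quat R) (c : bool * bool) : R :=
  match c with
  | (false, false) => qRe x | (false, true) => qI x
  | (true, false) => qJ x | (true, true) => qK x
  end.

Lemma qcoord_eq0 x : (forall c, qcoord x c = 0) -> x = 0.
Proof.
case: x => a b c d h.
by have := (h (false, false), h (false, true), h (true, false), h (true, true));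
  move=> /= [[[-> ->] ->] ->].
Qed.

(** There are more powers [M ^+ k], for k up to the real dimension, than that
dimension, so they satisfy a nontrivial real linear relation: a vector in the
left kernel of the matrix B whose rows list their real coordinates. *)
Lemma annihilating_poly M : exists2 q : {poly R}, q != 0 & ev M q = 0.
Proof.
pose I := ('I_n.+1 * 'I_n.+1 * (bool * bool))%type.
pose B : 'M[R]_(#|{: I}|.+1, #|{: I}|) :=
  \matrix_(k, t) let: (i, j, c) := enum_val t in qcoord ((M ^+ k) i j) c.
have : kermx B != 0.
  by rewrite kermx_eq0 /row_free neq_ltn ltnS rank_leq_col.
case/rowV0Pn=> u /sub_kermxP uB u0.
exists (\poly_(k < #|{: I}|.+1) u 0 (inord k)).
  apply: contraNneq u0 => /polyP q0; apply/eqP/rowP=> k.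
  by have := q0 k; rewrite coef_poly ltn_ord coef0 inord_val mxE.
apply/matrixP=> i j; rewrite mxE; apply: qcoord_eq0 => c.
have := congr1 (fun v : 'rV_ _ => v 0 (enum_rank (i, j, c))) uB.
rewrite !mxE => uB0; rewrite -[RHS]uB0 poly_def rmorph_sum summxE.
rewrite (big_morph (qcoord^~ c) (id1 := 0) (op1 := +%R)); first last.
- by case: c {uB0} => [[] []].
- by case: c {uB0} => [[] []].
apply: eq_bigr => k _; rewrite inord_val -mul_polyC rmorphM rmorphXn /=.
rewrite horner_morphX horner_morphC mul_realmx mxE enum_rankK.
move: (u 0 k) ((M ^+ k) i j) => a x.
by case: c {uB0} => [[] []] /=; ring.
Qed.

End RealPolynomials.

(** * Interpolation and real factorization *)

(** By induction on the nodes: a multiple of the monic polynomial vanishing at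
the earlier nodes adjusts the value at the new one. *)
Lemma interpolation (F : fieldType) (f : F -> F) (s : seq F) : uniq s ->
  exists p : {poly F}, forall a, a \in s -> p.[a] = f a.
Proof.
elim: s => [_|b s IH /= /andP[bs us]]; first by exists 0.
have [p hp] := IH us; pose w := \prod_(c <- s) ('X - c%:P).
have wb : w.[b] != 0 by rewrite -rootE root_prod_XsubC.
exists (p + ((f b - p.[b]) / w.[b]) *: w) => a; rewrite inE hornerD hornerZ.
case/predU1P=> [-> | sa]; first by rewrite divfK // addrC subrK.
have /rootP-> : root w a by rewrite root_prod_XsubC.
by rewrite mulr0 addr0 hp.
Qed.

(** Take a root of q in R[i]. If it is x + i y with y nonzero, dividing q by
(X - x)^2 + y^2 leaves a remainder of degree at most 1 with a root off the real
line, hence zero. *)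
Lemma real_poly_factor (R : rcfType) (q : {poly R}) : (1 < size q)%N ->
  exists g f, [/\ q = g * f, (size g < size q)%N &
    (exists x, f = 'X - x%:P) \/
    (exists x y, y != 0 /\ f = ('X - x%:P) ^+ 2 + (y ^+ 2)%:P)].
Proof.
move=> q1; have q0 : q != 0 by apply: contraTneq q1 => ->; rewrite size_poly0.
have ltgq g f : q = g * f -> (1 < size f)%N -> (size g < size q)%N.
  move=> qE f1; move: q0; rewrite qE mulf_eq0 negb_or => /andP[g0 f0].
  rewrite size_mul //; case: (size f) f1 => [|[|k]] // _.
  by rewrite !addnS /= ltnS leq_addr.
have : size (map_poly (real_complex R) q) != 1%N.
  by rewrite size_map_poly neq_ltn q1 orbT.
case/closed_rootP=> [[x y]] rz; have [y0|y0] := eqVneq y 0.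
  move: rz; rewrite y0 complexr0 fmorph_root => /factor_theorem[g qE].
  exists g, ('X - x%:P); split=> //; last by left; exists x.
  by apply: (ltgq _ _ qE); rewrite size_XsubC.
set d := ('X - x%:P) ^+ 2 + (y ^+ 2)%:P.
have sd : size d = 3%N.
  by rewrite size_polyDl size_exp_XsubC // ltnS (leq_trans (size_polyC_leq1 _)).
have d0 : d != 0 by rewrite -size_poly_eq0 sd.
have sr : (size (q %% d)%R <= 2)%N by rewrite -ltnS -sd ltn_modp.
have dz : (map_poly (real_complex R) d).[(x +i* y)%C] = 0.
  rewrite rmorphD rmorphXn /= map_polyXsubC map_polyC /= hornerD hornerC.
  rewrite horner_exp hornerXsubC; simpc; apply/eqP; rewrite eq_complex /=.
  by apply/andP; split; apply/eqP; ring.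
have : (map_poly (real_complex R) (q %% d)).[(x +i* y)%C] = 0.
  move/rootP: rz; rewrite {1}(divp_eq q d) rmorphD rmorphM /= hornerD hornerM.
  by rewrite dz mulr0 add0r.
(* The value at x + i y of a polynomial r of degree at most 1 has imaginary part
   y * r`_1 and real part r`_0 + x * r`_1. *)
rewrite (@horner_coef_wide _ 2) ?size_map_poly //.
rewrite !big_ord_recr big_ord0 /= !coef_map add0r; simpc => /eqP.
rewrite eq_complex /= => /andP[/eqP r0 /eqP r1].
have {}r1 : (q %% d)`_1 = 0.
  by apply: (mulIf y0); rewrite mul0r; lra.
have {}r0 : (q %% d)`_0 = 0 by rewrite r1 in r0; lra.
have r2 : q %% d = 0.
  apply/polyP=> -[|[|k]]; rewrite coef0 //.
  by rewrite nth_default // (leq_trans sr).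
have qE : q = (q %/ d) * d by rewrite [LHS](divp_eq q d) r2 addr0.
exists (q %/ d), d; split=> //; last by right; exists x, y.
by apply: (ltgq _ _ qE); rewrite sd.
Qed.

(** * The inverse square root of a Gram matrix *)

Section PositiveMatrix.
Variables (R : rcfType) (n : nat).
Notation MH := 'M[quat R]_n.+1.
Notation ev M := (horner_morph (realmx_comm M)).
Implicit Types (N : MH) (q : {poly R}) (a : R).
Variables P Q : MH.
Hypothesis QP : Q * P = 1.
Notation M := (adjmx P * P).

Lemma adjmx_gram : adjmx M = M.
Proof. by rewrite [LHS]adjmxM adjmxK. Qed.

Lemma adjmxBreal N a : adjmx N = N -> adjmx (N - realmx n a) = N - realmx n a.
Proof. by move=> hN; rewrite adjmxB hN adjmx_real. Qed.

(** N^* (M - a) N = (P N)^* (P N) + (b N)^* (b N), where b^2 = - a. *)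
Lemma nonpos_shift_inj a N : a <= 0 -> (M - realmx n a) * N = 0 -> N = 0.
Proof.
move=> a0 h; suff PN : P * N = 0 by rewrite -[N]mul1r -QP -mulrA PN mulr0.
pose b := realmx n (Num.sqrt (- a)).
have bb : b * b = - realmx n a.
  by rewrite -rmorphM -expr2 sqr_sqrtr ?oppr_ge0 // rmorphN.
apply: (@adjmx_sum_sqr_eq0 _ _ (P * N) (b * N)).
rewrite [adjmx (P * N)]adjmxM [adjmx (b * N)]adjmxM adjmx_real.
rewrite -[LHS]/(adjmx N * adjmx P * (P * N) + adjmx N * b * (b * N)).
rewrite -!mulrA -mulrDr [b * _]mulrA bb mulrA -mulrDl.
by rewrite -[X in _ * (X * _)]/(M - realmx n a) h mulr0.
Qed.

(** N^* X^2 N = (X N)^* (X N) for the Hermitian matrix X = M - a. *)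
Lemma shift_sqr_inj a N :
  (M - realmx n a) ^+ 2 * N = 0 -> (M - realmx n a) * N = 0.
Proof.
move=> h; apply: (@adjmx_sum_sqr_eq0 _ _ _ 0).
rewrite mulmx0 addr0 [adjmx (_ * _)]adjmxM adjmxBreal ?adjmx_gram //.
rewrite -[LHS]/(adjmx N * (M - realmx n a) * ((M - realmx n a) * N)).
by rewrite -mulrA [_ * (_ * N)]mulrA -expr2 h mulr0.
Qed.

(** N^* (X^2 + b^2) N = (b N)^* (b N) + (X N)^* (X N) for X = M - a. *)
Lemma irreducible_quadratic_inj a b N : b != 0 ->
  ((M - realmx n a) ^+ 2 + realmx n (b ^+ 2)) * N = 0 -> N = 0.
Proof.
move=> b0 h; suff bN : realmx n b * N = 0.
  by rewrite -[N]mul1r -(rmorph1 (realmx n)) -(mulVf b0) rmorphM -mulrA bN mulr0.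
apply: (@adjmx_sum_sqr_eq0 _ _ (realmx n b * N) ((M - realmx n a) * N)).
rewrite ![adjmx (_ * _)]adjmxM adjmx_real adjmxBreal ?adjmx_gram //.
set X := M - _; set b' := realmx n b.
rewrite -[LHS]/(adjmx N * b' * (b' * N) + adjmx N * X * (X * N)).
rewrite -!mulrA -mulrDr ![_ * (_ * N)]mulrA -mulrDl addrC -expr2.
by rewrite -rmorphM -expr2 h mulr0.
Qed.

(** The arbitrary right factor N makes the induction on the degree of q work:
a factor that is injective on the left is cancelled, while a factor X - x with
x > 0 is moved into N, and put back at the end unless x is already a root of
the product obtained, in which case [shift_sqr_inj] absorbs it. *)
Lemma positive_split q N : q != 0 -> ev M q * N = 0 ->
  exists s, [/\ uniq s, all (> 0) s & ev M (\prod_(a <- s) ('X - a%:P)) * N = 0].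
Proof.
have [k] := ubnP (size q); elim: k q N => // k IH q N.
have [q1|q1 szk q0 hq] := leqP (size q) 1.
  move=> _; rewrite (size1_polyC q1) polyC_eq0 horner_morphC => c0 hq.
  exists [::]; split=> //; suff -> : N = 0 by rewrite mulr0.
  by rewrite -[N]mul1r -(rmorph1 (realmx n)) -(mulVf c0) rmorphM -mulrA hq mulr0.
have [g [f [qE szg shape]]] := real_poly_factor q1.
have [g0 f0] : g != 0 /\ f != 0.
  by move: q0; rewrite qE mulf_eq0 negb_or => /andP.
have {}szg : (size g < k)%N by apply: leq_trans szg _.
case: shape => [[x fE]|[x [y [y0 fE]]]]; last first.
  apply: IH szg g0 _; move: hq; rewrite qE mulrC rmorphM /= -mulrA fE.
  rewrite rmorphD rmorphXn /= evXsubC horner_morphC.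
  exact: irreducible_quadratic_inj.
have [x0|x0] := leP x 0.
  apply: IH szg g0 _; move: hq; rewrite qE mulrC rmorphM /= -mulrA fE evXsubC.
  exact: nonpos_shift_inj.
have [|s [us s0 hs]] := IH g (ev M f * N) szg g0.
  by rewrite mulrA -rmorphM -qE.
have [xs|xs] := boolP (x \in s); last first.
  exists (x :: s); split; rewrite /= ?xs ?x0 //.
  by rewrite big_cons mulrC rmorphM /= -mulrA -fE.
exists s; split=> //; move: hs; rewrite (perm_big _ (perm_to_rem xs)) big_cons /=.
set w := \prod_(a <- rem x s) _ => hs.
rewrite rmorphM /= -mulrA evXsubC; apply: shift_sqr_inj.
move: hs; rewrite mulrA -rmorphM fE mulrAC -expr2 rmorphM rmorphXn /= evXsubC.
by rewrite mulrA.
Qed.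

(** The polynomial p^2 X - 1 vanishes at the distinct roots supplied by
[positive_split], so their annihilating product divides it. *)
Lemma inverse_sqrt : exists p, ev M p * ev M p * M = 1.
Proof.
have [q q0 hq] := annihilating_poly M.
have [|s [us s0 hs]] := @positive_split q 1 q0; first by rewrite hq mul0r.
have [p hp] := interpolation (fun a => (Num.sqrt a)^-1) us.
exists p; suff /dvdpP[g gE] : \prod_(a <- s) ('X - a%:P) %| p * p * 'X - 1.
  have /eqP : ev M (p * p * 'X - 1) = 0.
    by rewrite gE rmorphM /= -[X in _ * X]mulr1 hs mulr0.
  by rewrite rmorphB !rmorphM /= rmorph1 horner_morphX subr_eq0 => /eqP.
apply: uniq_roots_dvdp; last by rewrite uniq_rootsE.
apply/allP=> a sa; have a0 := allP s0 _ sa.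
rewrite rootE !hornerE hp // -expr2 exprVn sqr_sqrtr ?ltW //.
by rewrite mulVf ?subrr // gt_eqF.
Qed.

End PositiveMatrix.

(** * Polar decomposition and intertwiners *)

(** The last clause is what is kept of the fact that T is a real polynomial in
the Gram matrix. Size 0 is treated apart because evaluating a polynomial needs
a nontrivial ring. *)
Lemma gram_inverse_sqrt (R : rcfType) (n : nat) (P Q : 'M[quat R]_n) :
  Q *m P = 1%:M ->
  exists T, [/\ adjmx T = T, T *m T *m (adjmx P *m P) = 1%:M &
    forall X, X *m (adjmx P *m P) = adjmx P *m P *m X -> X *m T = T *m X].
Proof.
case: n P Q => [P Q _|n P Q QP].
  by exists 1%:M; split=> [||X _]; apply/matrixP=> -[].
have [p hp] := inverse_sqrt QP.
exists (horner_morph (realmx_comm (adjmx P * P)) p); split=> [||X].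
- exact/adjmx_ev/adjmx_gram.
- exact: hp.
- exact: ev_comm.
Qed.

(** The unitary factor U = P (P^* P)^(-1/2) of P intertwines whatever P
intertwines together with adjoints. Taking adjoints in the second hypothesis
gives X P^* = P^* Y, so that X commutes with P^* P. *)
Lemma polar_intertwiner (R : rcfType) (n : nat) (P Q : 'M[quat R]_n) :
  is_inverse P Q ->
  exists2 U, unitary U & forall X Y : 'M[quat R]_n,
    P *m X = Y *m P -> P *m adjmx X = adjmx Y *m P -> U *m X = Y *m U.
Proof.
case=> PQ QP; have [T [hT TTM Tcomm]] := gram_inverse_sqrt QP.
have TT : T *m T = Q *m adjmx Q.
  have MV : adjmx P *m P *m (Q *m adjmx Q) = 1%:M.
    by rewrite mulmxA -(mulmxA _ P) PQ mulmx1 -adjmxM QP adjmx1.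
  by rewrite -[LHS]mulmx1 -MV mulmxA TTM mul1mx.
have TM : adjmx P *m P *m T = T *m (adjmx P *m P) by apply: Tcomm.
exists (P *m T).
  split; rewrite adjmxM hT.
    rewrite mulmxA -(mulmxA P) TT !mulmxA PQ mul1mx.
    by rewrite -adjmxM PQ adjmx1.
  by rewrite -mulmxA (mulmxA (adjmx P)) TM mulmxA.
move=> X Y PX PXa.
have XP : X *m adjmx P = adjmx P *m Y.
  by rewrite -[X]adjmxK -adjmxM PXa adjmxM adjmxK.
rewrite -mulmxA -Tcomm; first by rewrite mulmxA PX -mulmxA.
by rewrite mulmxA XP -mulmxA -PX mulmxA.
Qed.

(** * Removing the twist by a unit imaginary quaternion *)

Section HSH.
Variables (R : rcfType) (n : nat) (phi : quat R).
Hypothesis hphi : unit_imag phi.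
Notation MH := 'M[quat R]_n.
Notation F := (phi%:M : MH).
Implicit Types A B U P S : MH.

Lemma qconj_imag : qconj phi = - phi.
Proof.
case: hphi => _; case: phi => a b c d /= ->.
by rewrite /qconj -[RHS]/(Defs.oppq _) /Defs.oppq /= oppr0.
Qed.

Lemma imag_mx_sqr : F *m F = - 1%:M.
Proof.
have [+ _] := unit_imag_mul hphi; rewrite qconj_imag mulNr => h.
by rewrite -scalar_mxM -[phi * phi]opprK h raddfN.
Qed.

Lemma phi_conjE A : phi_conj phi A = - (F *m A *m F).
Proof.
have mulF B i j : (B *m F) i j = B i j * phi.
  rewrite mxE (bigD1 j) //= big1 => [|k kj].
    by rewrite !mxE eqxx addr0 mulr1n.
  by rewrite !mxE (negPf kj) mulr0.
apply/matrixP=> i j; rewrite [RHS]mxE mulF mul_scalar_mx !mxE.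
by rewrite qconj_imag !mulNr.
Qed.

Lemma adjmx_imag : adjmx F = - F.
Proof. by rewrite adjmx_scalar qconj_imag raddfN. Qed.

Lemma phi_adjE A : phi_adj phi A = - (F *m adjmx A *m F).
Proof. exact: phi_conjE. Qed.

Lemma mul_imag_imag A : A *m F *m F = - A.
Proof. by rewrite -mulmxA imag_mx_sqr mulmxN mulmx1. Qed.

Lemma phi_adjK : involutive (@phi_adj R n phi).
Proof.
move=> A; rewrite !phi_adjE adjmxN !adjmxM adjmxK adjmx_imag.
rewrite !(mulmxN, mulNmx) !opprK !mulmxA.
by rewrite imag_mx_sqr mul_imag_imag mulNmx mul1mx opprK.
Qed.

(** This makes the decomposition natural: U sends the phi-adjoint of A to that
of the congruent matrix, hence parts to parts. *)
Lemma phi_adj_congr U A :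
  phi_adj phi (U *m A *m phi_adj phi U) =
  U *m phi_adj phi A *m phi_adj phi U.
Proof.
rewrite !phi_adjE !(adjmxM, adjmxN) adjmxK adjmx_imag.
rewrite !(mulmxN, mulNmx) !opprK !mulmxA.
by rewrite imag_mx_sqr mul_imag_imag !(mulNmx, mul1mx, opprK).
Qed.

Lemma phi_adjD : {morph @phi_adj R n phi : A B / A + B}.
Proof.
by move=> A B; rewrite !phi_adjE adjmxD mulmxDr mulmxDl opprD.
Qed.

Lemma phi_adjN : {morph @phi_adj R n phi : A / - A}.
Proof. by move=> A; rewrite !phi_adjE adjmxN mulmxN mulNmx. Qed.

(** In the decomposition one half is a quaternion scalar, which may be moved
across matrix products only because it is central. *)
Lemma half_comm (x : quat R) : GRing.comm x 2^-1.
Proof. by apply/commrV/commr_nat. Qed.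

Lemma mul_mx_half U A : U *m (2^-1 *: A) = 2^-1 *: (U *m A).
Proof.
apply/matrixP=> i j; rewrite !mxE mulr_sumr; apply: eq_bigr => k _.
by rewrite mxE !mulrA half_comm.
Qed.

Lemma phi_adj_half A : phi_adj phi (2^-1 *: A) = 2^-1 *: phi_adj phi A.
Proof.
have half_conj : qconj (2^-1) = 2^-1 :> quat R.
  have -> : 2%:R = Quat 2 0 0 0 :> quat R.
    by rewrite mulr2n -[LHS]/(Defs.addq 1 1) /Defs.addq /= !addr0.
  by rewrite -[_^-1]/(Defs.invq _) /Defs.invq /qconj /= !(oppr0, mul0r).
apply/matrixP=> i j.
rewrite !mxE qconjM half_conj (half_comm (qconj _)) !mulrA.
by rewrite (half_comm (qconj phi)).
Qed.

Lemma HSH_adj A S K : is_phi_HSH phi A S K ->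
  phi_adj phi S = S /\ phi_adj phi K = - K.
Proof.
case=> _ -> ->; rewrite !phi_adj_half !phi_adjD phi_adjN phi_adjK.
by split; [rewrite addrC | rewrite -scalerN opprB].
Qed.

Lemma phi_congr_HSH U A S1 K1 B S2 K2 :
  is_phi_HSH phi A S1 K1 -> is_phi_HSH phi B S2 K2 ->
  phi_congr_by phi U A B -> phi_congr_by phi U S1 S2 /\ phi_congr_by phi U K1 K2.
Proof.
move=> [_ -> ->] [_ -> ->] <-; rewrite /phi_congr_by phi_adj_congr.
by rewrite !mul_mx_half -!scalemxAl mulmxDr mulmxBr mulmxDl mulmxBl.
Qed.

Lemma phi_sim_intertwine P S1 S2 :
  phi_sim_by phi P S1 S2 -> P *m (S1 *m F) = S2 *m F *m P.
Proof.
case=> Q [_ QP] <-; rewrite mulmxA; move: (P *m S1) => X.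
rewrite -[in LHS](mulmx1 X) -QP phi_conjE.
by rewrite !(mulmxN, mulNmx) !mulmxA mul_imag_imag opprK.
Qed.

Lemma intertwine_phi_congr U S1 S2 : unitary U ->
  U *m (S1 *m F) = S2 *m F *m U -> phi_congr_by phi U S1 S2.
Proof.
case=> UU _ h; rewrite /phi_congr_by phi_adjE mulmxN !mulmxA.
by rewrite -(mulmxA U) h -(mulmxA _ U) UU mulmx1 mul_imag_imag opprK.
Qed.

(** Membership in the parts S and K thus becomes being skew-Hermitian and
Hermitian, respectively, after multiplication by F. *)
Lemma adjmx_mul_imag S : adjmx (S *m F) = - (phi_adj phi S *m F).
Proof.
by rewrite adjmxM adjmx_imag phi_adjE !mulNmx mul_imag_imag !opprK.
Qed.

(** The signs in the relations (S F)^* = - S F and (K F)^* = K F agree for both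
families, so P intertwines the adjoints as soon as it intertwines the matrices
themselves. *)
Lemma pair_phi_similar_congr S1 K1 S2 K2 :
  phi_adj phi S1 = S1 -> phi_adj phi K1 = - K1 ->
  phi_adj phi S2 = S2 -> phi_adj phi K2 = - K2 ->
  pair_phi_similar phi S1 K1 S2 K2 ->
  pair_unitarily_phi_congruent phi S1 K1 S2 K2.
Proof.
move=> hS1 hK1 hS2 hK2 [P [Q PQ] [/phi_sim_intertwine simS /phi_sim_intertwine simK]].
have [U unU hU] := polar_intertwiner PQ.
exists U => //; split; apply: (intertwine_phi_congr unU); apply: hU => //.
  by rewrite !adjmx_mul_imag hS1 hS2 mulmxN mulNmx simS.
by rewrite !adjmx_mul_imag hK1 hK2 !mulNmx !opprK simK.
Qed.

End HSH.

Theorem theorem4p14 (R : realType) (n : nat) (phi : quat R)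
    (A B S1 K1 S2 K2 : 'M[quat R]_n)
    (hphi : unit_imag phi)
    (hA : is_phi_HSH phi A S1 K1) (hB : is_phi_HSH phi B S2 K2) :
  [<-> unitarily_phi_congruent phi A B;
       pair_unitarily_phi_congruent phi S1 K1 S2 K2;
       pair_phi_similar phi S1 K1 S2 K2].
Proof.
tfae.
- by case=> U unU UAB; exists U => //; apply: phi_congr_HSH hA hB UAB.
- case=> U unU [/(unitary_phi_sim _ _ hphi unU) congS].
  move=> /(unitary_phi_sim _ _ hphi unU) congK.
  by exists U => //; exists (adjmx U).
- have [hS1 hK1] := HSH_adj hphi hA; have [hS2 hK2] := HSH_adj hphi hB.
  case/(pair_phi_similar_congr hphi hS1 hK1 hS2 hK2) => U unU [congS congK].
  exists U => //; case: hA hB => -> _ _ [-> _ _].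
  by rewrite /phi_congr_by mulmxDr mulmxDl congS congK.
Qed.
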